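(* Let $(a_n : n \in \mathbb{N}_0)$ and $(b_n : n \in \mathbb{N}_0)$ be sequences, and write $$f(x) = \sum_{n=0}^{\infty} x^{n+\frac12} a_n, \qquad \mathfrak{g}(x) = \sum_{n=0}^{\infty} x^{n+\frac12} b_n .$$ Assume that the application of $\langle\cdot,\cdot\rangle$ and infinite summation may be interchanged in both of the inner products displayed in the conclusion below, i.e. that $$\int_0^1 f(x)\,\mathfrak{g}(1-x)\,dx = \sum_{n=0}^{\infty}\sum_{m=0}^{\infty} a_n b_m \int_0^1 x^{n+\frac12}(1-x)^{m+\frac12}\,dx$$ and $$\int_0^1 \left(\sum_{n=0}^{\infty} \frac{\Gamma\left(n+\frac32\right)}{\Gamma(n+1)} (1-x)^n a_n\right)\left(\sum_{m=0}^{\infty} \frac{\Gamma\left(m+\frac32\right)}{\Gamma(m+2)} x^{m+1} b_m\right) dx = \sum_{n=0}^{\infty}\sum_{m=0}^{\infty} a_n b_m \frac{\Gamma\left(n+\frac32\right)}{\Gamma(n+1)} \frac{\Gamma\left(m+\frac32\right)}{\Gamma(m+2)} \int_0^1 (1-x)^n x^{m+1}\,dx ,$$ where all integrals and series involved are assumed to exist/converge. Then $$\left\langle f(x), \mathfrak{g}(1-x) \right\rangle = \left\langle \sum_{n=0}^{\infty} \frac{\Gamma\left(n+\frac32\right)}{\Gamma(n+1)} (1-x)^n a_n,\ \sum_{n=0}^{\infty} \frac{\Gamma\left(n+\frac32\right)}{\Gamma(n+2)} x^{n+1} b_n \right\rangle .$$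
   Context: $\mathbb{N}_0 = \{0,1,2,\ldots\}$, $\Gamma$ is the Gamma function, and $\langle u, v\rangle = \int_0^1 u(x)\, v(x)\, dx$ for functions $u, v$ on $(0,1)$. *)

(* Defs.v *)
From mathcomp Require Export all_boot all_order all_algebra.
From mathcomp Require Export all_classical all_reals all_analysis.
Export Order.TTheory GRing.Theory Num.Theory numFieldNormedType.Exports.

#[export] Set Implicit Arguments.
#[export] Unset Strict Implicit.
#[export] Unset Printing Implicit Defensive.

Local Open Scope classical_set_scope.
Local Open Scope ring_scope.

(* The library gives this notation only for extended reals.  It is a limit of
   partial sums, with a junk value when the series diverges. *)
Notation "\sum_ ( m <= i '<oo' ) F" :=
  (\big[+%R/0%R]_(m <= i <oo) F%R) : ring_scope.

(* Euler's integral; meaningful only for 0 < s. *)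
Definition Gamma {R : realType} (s : R) : R :=
  \int[lebesgue_measure]_(t in `]0, +oo[) (t `^ (s - 1) * expR (- t)).

Definition inner {R : realType} (u v : R -> R) : R :=
  \int[lebesgue_measure]_(x in `]0, 1[) (u x * v x).

(* [inner] takes a junk value when the integral does not exist; this is the
   existence of the integral, in the Lebesgue sense. *)
Definition inner_exists {R : realType} (u v : R -> R) : Prop :=
  (@lebesgue_measure R).-integrable `]0, 1[ (fun x => (u x * v x)%:E).

(* Convergence of the iterated series \sum_n (\sum_m c n m); neither absolute
   convergence nor convergence as a double series is required. *)
Definition iterated_cvg {R : realType} (c : nat -> nat -> R) : Prop :=
  (forall n, cvgn (series (c n))) /\
  cvgn (series (fun n => \sum_(0 <= m <oo) c n m)).

(* Main.v *)
Require Import Defs.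
From mathcomp Require Import measurable_realfun.
From mathcomp Require Import ring lra.

Local Open Scope classical_set_scope.
Local Open Scope ring_scope.

(** Once the inner products are expanded into iterated series, these two series
    agree term by term.  With [B(a, b)] the Euler beta integral of
    [x^(a-1) (1-x)^(b-1)] over (0, 1), the inner products inside the two series
    are [B(n+3/2, m+3/2)] and [B(m+2, n+1)].  By Euler's relation
    [Gamma a * Gamma b = Gamma (a+b) * B(a, b)] (lemma [GammaM]), their products
    with [Gamma (n+m+3)] are [Gamma (n+3/2) * Gamma (m+3/2)] and
    [Gamma (m+2) * Gamma (n+1)]: the two arguments add up to the same number
    [n+m+3] in both cases, which is the coincidence behind the theorem.
    Dividing by the positive number [Gamma (n+m+3)] identifies the terms
    ([inner_half_integer_powers]).

    Euler's relation is the statement that gamma densities are stable under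
    convolution.  Write [g_a] for [t^(a-1) e^(-t)] on the positive half-line and
    0 elsewhere.  By Tonelli, [Gamma a * Gamma b] is the integral over [u] of
    the convolution of [g_a] and [g_b] at [u]; the substitution [t = u x] turns
    that convolution into [g_(a+b) u * B(a, b)] ([integral_gammaM]).  All
    integrands are nonnegative, so this is an identity of extended reals.  For
    [a, b >= 1] the gamma integrals are finite and positive
    ([integral_gamma_lty], [integral_gamma_gt0]); the identity then forces the
    beta integral to be finite as well, and becomes one of real numbers. *)

(** * Affine change of variables for the Lebesgue measure *)

Section affine_change_of_variables.
Context {R : realType} (c d : R).
Hypothesis c_gt0 : 0 < c.
Local Notation mu := (@lebesgue_measure R).

Let phi : measurableTypeR R -> measurableTypeR R := fun x => c * x + d.

Let mphi : measurable_fun setT phi.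
Proof. by apply: measurable_funD => //; exact: measurable_funM. Qed.

Let nu : {measure set (measurableTypeR R) -> \bar R}.
Proof.
by refine (mscale (NngNum (ltW c_gt0)) (pushforward mu phi)); exact: mphi.
Defined.

(** Both sides are measures, and they agree on bounded half-open intervals. *)
Let lebesgue_measure_affine (A : set R) : measurable A ->
  mu A = (c%:E * mu (phi @^-1` A))%E.
Proof.
move=> mA.
rewrite (_ : (c%:E * _)%E = nu A)//.
apply: lebesgue_measure_unique => //= _ [[a b]] _ <-.
rewrite /nu /mscale/= /pushforward.
have -> : phi @^-1` `]a, b] = `](a - d) / c, (b - d) / c]%classic.
  apply/seteqP; split => x /=; rewrite !in_itv/= /phi;
  by rewrite ltr_pdivrMr// ler_pdivlMr// [x * c]mulrC ltrBlDr lerBrDr.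
rewrite !lebesgue_measure_itv/= !lte_fin ltr_pM2r ?invr_gt0// ltrBlDr subrK.
case: ifPn => _; last by rewrite mule0.
by rewrite -!EFinB -EFinM; congr EFin; field; rewrite gt_eqF.
Qed.

(** The transfer theorem for the image of the measure under the affine map.
    Stated for measurable functions, since it is meant for densities cut off by
    an indicator function, which are discontinuous. *)
Lemma ge0_integral_affine (f : R -> \bar R) :
  measurable_fun setT f -> (forall x, (0 <= f x)%E) ->
  (\int[mu]_x f x = c%:E * \int[mu]_x f (c * x + d)%R)%E.
Proof.
move=> mf f0.
transitivity (\int[nu]_x f x)%E.
  by apply: eq_measure_integral => A mA _; exact: lebesgue_measure_affine.
rewrite ge0_integral_mscale//=; congr (_ * _)%E.
by rewrite ge0_integral_pushforward.
Qed.

End affine_change_of_variables.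

(** * Euler's relation between the gamma and beta integrals *)

Section densities.
Context {R : realType}.
Implicit Types (a b s t u x : R).
Local Notation mu := (@lebesgue_measure R).

(** Extended by 0 to the whole line, so that translations and dilations of the
    variable never change the domain of integration. *)
Definition gamma_density s t : R :=
  \1_(`]0, +oo[%classic : set R) t * (t `^ (s - 1) * expR (- t)).

Definition beta_density a b x : R :=
  \1_(`]0, 1[%classic : set R) x * (x `^ (a - 1) * (1 - x) `^ (b - 1)).

Lemma gamma_density_ge0 s t : 0 <= gamma_density s t.
Proof. by rewrite !mulr_ge0// ?powR_ge0// expR_ge0. Qed.

Lemma beta_density_ge0 a b x : 0 <= beta_density a b x.
Proof. by rewrite !mulr_ge0// powR_ge0. Qed.

Lemma measurable_gamma_density s : measurable_fun setT (gamma_density s).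
Proof.
apply: measurable_funM; first exact: measurable_indic.
apply: measurable_funM; first exact: measurable_powR.
by apply: measurableT_comp => //; exact: oppr_measurable.
Qed.

Lemma measurable_beta_density a b : measurable_fun setT (beta_density a b).
Proof.
apply: measurable_funM; first exact: measurable_indic.
apply: measurable_funM; first exact: measurable_powR.
apply: (measurableT_comp (measurable_powR _)).
exact: measurable_funB.
Qed.

Lemma GammaE s : Gamma s = fine (\int[mu]_t (gamma_density s t)%:E)%E.
Proof.
rewrite /Gamma /Rintegral integral_mkcond; congr fine.
apply: eq_integral => t _; rewrite patchE /gamma_density indicE.
by case: ifPn => _; rewrite ?mul1r ?mul0r.
Qed.

Lemma innerE a b : inner (fun x => x `^ (a - 1)) (fun x => (1 - x) `^ (b - 1)) =
  fine (\int[mu]_x (beta_density a b x)%:E)%E.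
Proof.
rewrite /inner /Rintegral integral_mkcond; congr fine.
apply: eq_integral => t _; rewrite patchE /beta_density indicE.
by case: ifPn => _; rewrite ?mul1r ?mul0r.
Qed.

Lemma gamma_density_gt0E s t : 0 < t ->
  gamma_density s t = t `^ (s - 1) * expR (- t).
Proof.
by move=> t0; rewrite /gamma_density indicE mem_set/= ?mul1r// in_itv/= t0.
Qed.

Lemma gamma_density_le0 s t : t <= 0 -> gamma_density s t = 0.
Proof.
move=> t0; rewrite /gamma_density indicE memNset/= ?mul0r// in_itv/= andbT.
by apply/negP; rewrite -leNgt.
Qed.

Lemma gamma_density_conv_le0 a b t u : u <= 0 ->
  gamma_density a t * gamma_density b (u - t) = 0.
Proof.
move=> u0; have [t0|t0] := leP t 0; first by rewrite gamma_density_le0 ?mul0r.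
by rewrite [X in _ * X]gamma_density_le0 ?mulr0//; lra.
Qed.

(** Where [0 < x < 1], this is
    [u (u x)^(a-1) (u (1-x))^(b-1) = u^(a+b-1) x^(a-1) (1-x)^(b-1)] together
    with [e^(-u x) e^(-u (1-x)) = e^(-u)]; elsewhere both sides vanish, since
    [u x] or [u - u x] is then nonpositive. *)
Lemma gamma_density_conv_gt0 a b u x : 0 < u ->
  u * (gamma_density a (u * x) * gamma_density b (u - u * x)) =
  gamma_density (a + b) u * beta_density a b x.
Proof.
move=> u0; rewrite /beta_density indicE.
have [x01|] := boolP (x \in `]0, 1[%classic); last first.
  rewrite mul0r mulr0 notin_setE/= in_itv/= => /negP.
  rewrite negb_and -!leNgt => /orP[x0|x1].
    by rewrite gamma_density_le0 ?mul0r ?mulr0// mulr_ge0_le0// ltW.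
  rewrite [X in _ * (_ * X)]gamma_density_le0 ?mulr0//.
  by rewrite subr_le0 ler_peMr// ltW.
move: x01; rewrite inE/= in_itv/= => /andP[x0 x1]; rewrite mul1r.
have -> : u - u * x = u * (1 - x) by ring.
have y0 : 0 < 1 - x by lra.
rewrite !gamma_density_gt0E ?mulr_gt0// !powRM ?ltW//.
have -> : a + b - 1 = 1 + ((a - 1) + (b - 1)) by ring.
have powuD r r' : u `^ (r + r') = u `^ r * u `^ r'.
  by rewrite powRD// (gt_eqF u0) implybT.
rewrite (powuD 1) (powuD (a - 1)) powRr1 ?ltW//.
have -> : expR (- u) = expR (- (u * x)) * expR (- (u * (1 - x))).
  by rewrite -expRD; congr expR; ring.
ring.
Qed.

(** The product is the integral of [gamma_density a t * gamma_density b (u - t)]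
    over the plane, obtained by translating the second variable; integrating in
    [t] first and rescaling [t = u x] separates [u] from [x]. *)
Lemma integral_gammaM a b :
  (\int[mu]_t (gamma_density a t)%:E * \int[mu]_t (gamma_density b t)%:E =
   \int[mu]_t (gamma_density (a + b) t)%:E *
   \int[mu]_x (beta_density a b x)%:E)%E.
Proof.
have mgE s : measurable_fun setT (EFin \o gamma_density s).
  by apply/measurable_EFinP; exact: measurable_gamma_density.
have mbE : measurable_fun setT (EFin \o beta_density a b).
  by apply/measurable_EFinP; exact: measurable_beta_density.
have g0 s t : (0 <= (gamma_density s t)%:E)%E.
  by rewrite lee_fin gamma_density_ge0.
pose h (z : R * R) : \bar R :=
  (gamma_density a z.1 * gamma_density b (z.2 - z.1))%:E.
have h0 z : (0 <= h z)%E by rewrite lee_fin mulr_ge0 ?gamma_density_ge0.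
have mh : measurable_fun setT h.
  apply/measurable_EFinP/measurable_funM.
    by apply: (measurableT_comp (measurable_gamma_density _)).
  apply: (measurableT_comp (measurable_gamma_density _)).
  exact: measurable_funB.
transitivity (\int[mu]_t \int[mu]_u h (t, u))%E.
  rewrite -ge0_integralZr//; last 2 first.
    exact: mgE.
    exact: integral_ge0.
  apply: eq_integral => t _.
  rewrite (@ge0_integral_affine _ 1 (- t) _ (EFin \o gamma_density b))//;
    last by move=> x; exact: g0.
  rewrite mul1e -ge0_integralZl//.
  - by apply: eq_integral => u _; rewrite /h/= EFinM mul1r.
  - apply: (measurableT_comp (mgE b)).
    by apply: measurable_funD => //; exact: measurable_funM.
  - by move=> u _; exact: g0.
transitivity (\int[mu]_u \int[mu]_t h (t, u))%E; first exact: fubini_tonelli.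
rewrite -ge0_integralZr//; last 2 first.
  exact: mgE.
  by apply: integral_ge0 => x _; rewrite lee_fin beta_density_ge0.
apply: eq_integral => u _.
have [u0|u0] := leP (u : R) 0.
  rewrite gamma_density_le0// mul0e integral0_eq// => t _.
  by rewrite /h/= gamma_density_conv_le0.
rewrite (@ge0_integral_affine _ u 0)//; last first.
  by apply: (measurableT_comp mh); exact: pair2_measurable.
rewrite -!ge0_integralZl//; last 3 first.
- by move=> x _; rewrite lee_fin beta_density_ge0.
- apply: (measurableT_comp mh); apply: measurable_fun_pair => //.
  by apply: measurable_funD => //; exact: measurable_funM.
- by rewrite lee_fin ltW.
apply: eq_integral => x _.
by rewrite /h/= addr0 -!EFinM gamma_density_conv_gt0.
Qed.

(** Half of the decay of [e^(-t)] absorbs the power: raising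
    [t <= 2 s e^(t / (2 s))], an instance of [y <= e^y], to the exponent
    [s - 1] bounds [t^(s-1)] by a multiple of [e^(t (s-1) / (2 s))], which is at
    most the same multiple of [e^(t / 2)].  The remaining factor [e^(-t / 2)] is,
    up to a constant, the exponential density of rate [1 / 2]. *)
Lemma gamma_density_le_exponential s t : 1 <= s ->
  gamma_density s t <= (2 * s) `^ (s - 1) * 2 * exponential_pdf (1 / 2) t.
Proof.
move=> s1; have [t0|t0] := leP t 0.
  by rewrite gamma_density_le0// !mulr_ge0 ?powR_ge0// exponential_pdf_ge0.
rewrite gamma_density_gt0E// exponential_pdfE ?(ltW t0)//.
have -> : (2 * s) `^ (s - 1) * 2 * (1 / 2 * expR (- (1 / 2) * t)) =
    (2 * s) `^ (s - 1) * expR (t / 2) * expR (- t).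
  rewrite -[RHS]mulrA -expRD -mulrA; congr (_ * _).
  have -> : t / 2 + - t = - (1 / 2) * t by field.
  by field.
rewrite ler_pM2r ?expR_gt0//.
have s0 : 0 < s by lra.
have t_le : t <= 2 * s * expR (t / (2 * s)).
  rewrite mulrC -ler_pdivrMr; last lra.
  by have := expR_ge1Dx (t / (2 * s)); lra.
have := @ge0_ler_powR _ (s - 1) _ t (2 * s * expR (t / (2 * s))).
rewrite !nnegrE subr_ge0 => /(_ s1 (ltW t0)) le_pow.
apply: le_trans (le_pow _ t_le) _.
  by rewrite mulr_ge0 ?expR_ge0//; lra.
rewrite powRM ?expR_ge0//; last lra.
rewrite ler_pM2l ?powR_gt0 ?mulr_gt0// -expRM ler_expR.
rewrite -mulrA ler_pM2l//.
rewrite invfM -mulrA ler_piMr ?invr_ge0//.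
by rewrite mulrC ler_pdivrMr//; lra.
Qed.

Lemma integral_gamma_lty s : 1 <= s ->
  (\int[mu]_t (gamma_density s t)%:E < +oo)%E.
Proof.
move=> s1.
set C := (2 * s) `^ (s - 1) * 2.
have C0 : 0 <= C by rewrite mulr_ge0 ?powR_ge0.
apply: (@le_lt_trans _ _ (\int[mu]_t (C%:E * (exponential_pdf (1 / 2) t)%:E))%E).
  apply: ge0_le_integral => //.
  - by move=> t _; rewrite lee_fin gamma_density_ge0.
  - by apply/measurable_EFinP; exact: measurable_gamma_density.
  - apply/measurable_EFinP; apply: measurable_funM => //.
    exact: measurable_exponential_pdf.
  - by move=> t _; rewrite -EFinM lee_fin gamma_density_le_exponential.
rewrite ge0_integralZl//.
- by rewrite integral_exponential_pdf// ?mule1 ?ltry.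
- by apply/measurable_EFinP; exact: measurable_exponential_pdf.
- by move=> t _; rewrite lee_fin exponential_pdf_ge0.
Qed.

Lemma integral_gamma_gt0 s : 1 <= s ->
  (0 < \int[mu]_t (gamma_density s t)%:E)%E.
Proof.
move=> s1.
(* For [t] in [1, 2], [t^(s-1) >= 1] and [e^(-t) >= e^(-2)]. *)
have e0 : (0 < \int[mu]_(t in `[1%R, 2%R]) (expR (- 2))%:E)%E.
  rewrite integral_cst//= lebesgue_measure_itv/= lte_fin ltr1n/=.
  by rewrite -EFinB -EFinM lte_fin mulr_gt0 ?expR_gt0//; lra.
apply: (lt_le_trans e0).
apply: (@le_trans _ _ (\int[mu]_(t in `[1%R, 2%R]) (gamma_density s t)%:E)%E).
  apply: ge0_le_integral => //.
  - apply/measurable_EFinP; apply: measurable_funTS.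
    exact: measurable_gamma_density.
  - move=> t; rewrite /= in_itv/= => /andP[t1 t2].
    rewrite lee_fin gamma_density_gt0E; last lra.
    have p1 : 1 <= t `^ (s - 1) by rewrite -[leLHS](powRr0 t) ler_powR// subr_ge0.
    have e1 : expR (- 2) <= expR (- t) by rewrite ler_expR; lra.
    by rewrite -[leLHS]mul1r ler_pM// expR_ge0.
apply: ge0_subset_integral => //.
- by apply/measurable_EFinP; exact: measurable_gamma_density.
- by move=> t _; rewrite lee_fin gamma_density_ge0.
Qed.

Lemma Gamma_gt0 s : 1 <= s -> 0 < Gamma s.
Proof.
by move=> s1; rewrite GammaE fine_gt0// integral_gamma_gt0// integral_gamma_lty.
Qed.

Lemma GammaM a b : 1 <= a -> 1 <= b ->
  Gamma a * Gamma b =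
  Gamma (a + b) * inner (fun x => x `^ (a - 1)) (fun x => (1 - x) `^ (b - 1)).
Proof.
move=> a1 b1; have ab1 : 1 <= a + b by lra.
have fin s : 1 <= s -> (\int[mu]_t (gamma_density s t)%:E)%E \is a fin_num.
  move=> s1; rewrite ge0_fin_numE ?integral_gamma_lty//.
  exact/ltW/integral_gamma_gt0.
have B0 : (0 <= \int[mu]_x (beta_density a b x)%:E)%E.
  by apply: integral_ge0 => x _; rewrite lee_fin beta_density_ge0.
rewrite !GammaE innerE -fineM ?fin// integral_gammaM fineM ?fin//.
(* An infinite beta integral would make the finite left-hand side infinite. *)
rewrite ge0_fin_numE// ltey; apply/eqP => Boo.
have := integral_gammaM a b.
rewrite Boo gt0_muley ?integral_gamma_gt0// => abE.
by have := fin_numM (fin _ a1) (fin _ b1); rewrite abE.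
Qed.

End densities.

(** * Identification of the general terms *)

(** Euler's relation at [(n+3/2, m+3/2)] and at [(m+2, n+1)], compared through
    the common value [Gamma (n+m+3)]. *)
Lemma inner_half_integer_powers (R : realType) n m :
  let G := @Gamma R in
  inner (fun x : R => x `^ (n%:R + 1 / 2)) (fun x => (1 - x) `^ (m%:R + 1 / 2)) =
  G (n%:R + 3 / 2) / G (n%:R + 1) * (G (m%:R + 3 / 2) / G (m%:R + 2)) *
  inner (fun x => (1 - x) ^+ n) (fun x => x ^+ m.+1).
Proof.
move=> G.
have n0 : 0 <= n%:R :> R by [].
have m0 : 0 <= m%:R :> R by [].
have intE : inner (fun x : R => (1 - x) ^+ n) (fun x => x ^+ m.+1) =
    inner (fun x : R => x `^ (m%:R + 2 - 1)) (fun x => (1 - x) `^ (n%:R + 1 - 1)).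
  apply: eq_Rintegral => x; rewrite inE/= in_itv/= => /andP[x0 x1].
  rewrite mulrC addrK powR_mulrn; last lra.
  have -> : m%:R + 2 - 1 = m.+1%:R :> R by rewrite -natr1; ring.
  by rewrite powR_mulrn// ltW.
have halfE k : k%:R + 1 / 2 = k%:R + 3 / 2 - 1 :> R by field.
have n1 : 1 <= n%:R + 1 :> R by lra.
have m2 : 1 <= m%:R + 2 :> R by lra.
have n32 : 1 <= n%:R + 3 / 2 :> R by lra.
have m32 : 1 <= m%:R + 3 / 2 :> R by lra.
have nm3 : 1 <= n%:R + m%:R + 3 :> R by lra.
have sum_halves : n%:R + 3 / 2 + (m%:R + 3 / 2) = n%:R + m%:R + 3 :> R by field.
have sum_ints : m%:R + 2 + (n%:R + 1) = n%:R + m%:R + 3 :> R by ring.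
have := GammaM n32 m32; rewrite sum_halves -!halfE => halves.
have := GammaM m2 n1; rewrite sum_ints -intE => ints.
apply: (mulfI (lt0r_neq0 (Gamma_gt0 nm3))); rewrite -halves.
rewrite mulrCA -ints.
have := lt0r_neq0 (Gamma_gt0 n1); have := lt0r_neq0 (Gamma_gt0 m2).
rewrite /G; move: (Gamma _) (Gamma _) (Gamma _) (Gamma _) => x y z w.
by move=> *; field; apply/andP.
Qed.

Theorem theorem2 (R : realType) (a b : nat -> R) (f g : R -> R)
  (* f and g are the sums of their series on (0, 1) *)
  (hf : forall x : R, 0 < x < 1 ->
    series (fun n => x `^ (n%:R + 1 / 2) * a n) @ \oo --> f x)
  (hg : forall x : R, 0 < x < 1 ->
    series (fun n => x `^ (n%:R + 1 / 2) * b n) @ \oo --> g x)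
  (* the series on the right-hand side converge on (0, 1) *)
  (hu : forall x : R, 0 < x < 1 -> cvgn (series (fun n =>
    Gamma (n%:R + 3 / 2) / Gamma (n%:R + 1) * (1 - x) ^+ n * a n)))
  (hv : forall x : R, 0 < x < 1 -> cvgn (series (fun n =>
    Gamma (n%:R + 3 / 2) / Gamma (n%:R + 2) * x ^+ n.+1 * b n)))
  (* the two inner products exist *)
  (hfg : inner_exists f (fun x => g (1 - x)))
  (huv : inner_exists
    (fun x => \sum_(0 <= n <oo)
       (Gamma (n%:R + 3 / 2) / Gamma (n%:R + 1) * (1 - x) ^+ n * a n))
    (fun x => \sum_(0 <= n <oo)
       (Gamma (n%:R + 3 / 2) / Gamma (n%:R + 2) * x ^+ n.+1 * b n)))
  (* termwise integration of the first one *)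
  (hfg_cvg : iterated_cvg (fun n m => a n * b m *
    inner (fun x => x `^ (n%:R + 1 / 2)) (fun x => (1 - x) `^ (m%:R + 1 / 2))))
  (hfg_swap : inner f (fun x => g (1 - x)) =
    \sum_(0 <= n <oo) \sum_(0 <= m <oo) (a n * b m *
      inner (fun x => x `^ (n%:R + 1 / 2))
            (fun x => (1 - x) `^ (m%:R + 1 / 2))))
  (* termwise integration of the second one *)
  (huv_cvg : iterated_cvg (fun n m => a n * b m *
    (Gamma (n%:R + 3 / 2) / Gamma (n%:R + 1)) *
    (Gamma (m%:R + 3 / 2) / Gamma (m%:R + 2)) *
    inner (fun x => (1 - x) ^+ n) (fun x => x ^+ m.+1)))
  (huv_swap :
    inner
      (fun x => \sum_(0 <= n <oo)
         (Gamma (n%:R + 3 / 2) / Gamma (n%:R + 1) * (1 - x) ^+ n * a n))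
      (fun x => \sum_(0 <= m <oo)
         (Gamma (m%:R + 3 / 2) / Gamma (m%:R + 2) * x ^+ m.+1 * b m)) =
    \sum_(0 <= n <oo) \sum_(0 <= m <oo) (a n * b m *
      (Gamma (n%:R + 3 / 2) / Gamma (n%:R + 1)) *
      (Gamma (m%:R + 3 / 2) / Gamma (m%:R + 2)) *
      inner (fun x => (1 - x) ^+ n) (fun x => x ^+ m.+1))) :
  inner f (fun x => g (1 - x)) =
  inner
    (fun x => \sum_(0 <= n <oo)
       (Gamma (n%:R + 3 / 2) / Gamma (n%:R + 1) * (1 - x) ^+ n * a n))
    (fun x => \sum_(0 <= n <oo)
       (Gamma (n%:R + 3 / 2) / Gamma (n%:R + 2) * x ^+ n.+1 * b n)).
Proof.
rewrite hfg_swap huv_swap.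
congr (limn (series _)); apply/funext => n.
congr (limn (series _)); apply/funext => m.
by rewrite inner_half_integer_powers -!mulrA.
Qed.
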